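(* Let $\delta>0$ and let $M$ be a set of probability measures on $(0,\infty)$ such that: $M$, treated as a set of measures on $\mathbb{R}$, is weakly compact; $\operatorname{Span}(\mu)=\delta$ for all $\mu\in M$; and $M$ is uniformly integrable, that is, $\lim_{a\to+\infty}\sup_{\mu\in M}\int_{[a,\infty)}t\,\mu(\mathrm{d}t)=0$. Let $H$ be a set of functions $\{0,\delta,2\delta,\dots\}\to\mathbb{R}$ such that \[ \sup_{h\in H}\sum_{k=0}^\infty|h(k\delta)|<\infty\quad\text{and}\quad\lim_{n\to\infty}\sup_{h\in H}\sum_{k=n}^\infty|h(k\delta)|=0 . \] Then \[ (U_\mu*h)(n\delta)\to\delta\lambda_\mu\sum_{k=0}^\infty h(k\delta)\quad\text{as }n\to\infty, \] uniformly in $\mu\in M$ and $h\in H$.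
   Context: For a probability measure $\mu$ on $(0,\infty)$: - $\operatorname{Span}(\mu)=\max\bigl(\{\delta>0:\mu(\{\delta,2\delta,3\delta,\dots\})=1\}\cup\{0\}\bigr)$. - The renewal measure is $U_\mu=\sum_{n=0}^\infty\mu^{*n}$, where $\mu^{*n}$ is the $n$-fold convolution of $\mu$ with itself and $\mu^{*0}$ is the unit atom at $0$; it is a locally finite measure on $[0,\infty)$. - $\lambda_\mu=1/\int t\,\mu(\mathrm{d}t)$. ''Weakly compact'' refers to the topology of weak convergence of probability measures on $\mathbb{R}$. The convolution is $(U_\mu*h)(n\delta)=\sum_{k=0}^n U_\mu(\{(n-k)\delta\})\,h(k\delta)$. *)

(* Defs.v *)
From HB Require Import structures.
From mathcomp Require Import all_boot all_order all_algebra.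
From mathcomp Require Import all_classical all_reals all_analysis.
Import Order.TTheory GRing.Theory Num.Theory.
Import numFieldNormedType.Exports.

Set Implicit Arguments.
Unset Strict Implicit.
Unset Printing Implicit Defensive.

Local Open Scope classical_set_scope.
Local Open Scope ring_scope.

Notation real_probability R := (probability (measurableTypeR R) R).

Section weak_topology.
Variable R : realType.

Record bounded_continuous := BoundedContinuous {
  bcfun :> R -> R ;
  bcfun_continuous : continuous bcfun ;
  bcfun_bounded : bounded_fun bcfun }.

HB.instance Definition _ := gen_eqMixin bounded_continuous.
HB.instance Definition _ := gen_choiceMixin bounded_continuous.

Definition bc_integral (mu : real_probability R) :
    prod_topology (fun _ : bounded_continuous => R) :=
  fun f => \int[mu]_x (f x).

(* The topology of weak convergence: the coarsest one for which
   mu |-> \int f dmu is continuous for every bounded continuous f. *)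
Definition weak_probability : Type := initial_topology bc_integral.

HB.instance Definition _ := Topological.on weak_probability.

End weak_topology.

Section convolution.
Variable R : realType.

Definition radd (x : measurableTypeR R * measurableTypeR R) :
  measurableTypeR R := x.1 + x.2.

Lemma measurable_radd : measurable_fun setT radd.
Proof. exact: measurable_realfun.measurable_funD measurable_fst measurable_snd. Qed.

HB.instance Definition _ := isMeasurableFun.Build _ _ _ _ radd measurable_radd.

Definition convolution (mu nu : real_probability R) : real_probability R :=
  distribution (mu \x nu)%E radd.

Fixpoint convolution_power (mu : real_probability R) (n : nat) :
    real_probability R :=
  if n is n'.+1 then convolution mu (convolution_power mu n') else \d_((0 : R) : measurableTypeR R).

Definition renewal_measure (mu : real_probability R) :
    {measure set (measurableTypeR R) -> \bar R} :=
  mseries (convolution_power mu) 0.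

End convolution.

Section span.
Variable R : realType.

Definition span_candidates (mu : real_probability R) : set R :=
  [set d | 0 < d /\ mu [set k.+1%:R * d | k in [set: nat]] = 1%E]
    `|` [set 0].

(* The maximum of span_candidates; the default value of xget is never used for
   mu on (0, +oo), where this maximum exists. *)
Definition Span (mu : real_probability R) : R :=
  xget 0 [set d | span_candidates mu d /\ ubound (span_candidates mu) d].

(* When the mean is +oo, fine makes this 0, in accordance with 1 / +oo = 0. *)
Definition renewal_rate (mu : real_probability R) : R :=
  (fine (\int[mu]_t t%:E)%E)^-1.

Definition uniformly_integrable (M : set (real_probability R)) : Prop :=
  (ereal_sup [set \int[mu]_(t in `[a, +oo[) t%:E | mu in M] @[a --> +oo%R]
     --> 0)%E.

End span.

Section lattice.
Variables (R : realType) (delta : R).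

Definition lattice : set R := range (fun k : nat => k%:R * delta).

Lemma mem_lattice (k : nat) : k%:R * delta \in lattice.
Proof. by apply/mem_set; exists k. Qed.

Definition lattice_point (k : nat) : lattice := SigSub (mem_lattice k).

Definition lattice_convolution
    (U : {measure set (measurableTypeR R) -> \bar R}) (h : lattice -> R)
    (n : nat) : R :=
  \sum_(0 <= k < n.+1)
    fine (U [set (n - k)%:R * delta]) * h (lattice_point k).

Definition lattice_sum (h : lattice -> R) : R :=
  limn (series (fun k => h (lattice_point k))).

Definition lattice_abs_tail (h : lattice -> R) (n : nat) : \bar R :=
  (\sum_(n <= k <oo) `|h (lattice_point k)|%:E)%E.

End lattice.

(* Main.v *)
Require Import Defs.
From mathcomp Require Import all_boot all_order all_algebra.
From mathcomp Require Import all_classical all_reals all_analysis.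
From mathcomp Require Import measurable_realfun ring lra.
Import Order.TTheory GRing.Theory Num.Theory.
Import numFieldNormedType.Exports.

(** The theorem is a renewal theorem that holds uniformly over a compact family
of step laws, and it is proved by a compactness argument that contains the
classical theorem as the case of a constant family.

Write [p k = mu {k delta}], let [u n = U_mu {n delta}] and let
[r i = 1 - (p 0 + ... + p i)] be the tail of the step law.  Three facts about
one measure are used.  The sequence [u] solves the renewal equation
[u n.+1 = \sum_i p i.+1 * u (n - i)].  Since [r i.+1 = r i - p i.+1], summing
that equation gives [\sum_(i <= n) r i * u (n - i) = 1], hence [0 <= u <= 1].
And [\sum_i r i] is the mean [m] of [mu] in units of [delta], so that
[delta * lambda_mu = 1 / m].

Suppose that [u n] does not approach [1 / m] uniformly over [M].  Then there are
pairs [(n, mu)] with [n] arbitrarily large and [u n] at distance more than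
[eps] from [1 / m], and an ultrafilter [G] on such pairs
([uniform_renewal]).  Along [G] the measures converge weakly to some [mu0] in
[M], hence [p] converges pointwise, because tent functions around the lattice
points read off the atoms ([weak_compact_weights]); uniform integrability
makes [m] converge as well ([mean_cvg]).  The numbers [u (n - k)] are bounded,
so they have limits [w k] for every [k], and the renewal equation becomes, in
the limit, [w k = \sum_i p0 i * w (k + i)] ([renewal_limit]): the sequence [w]
is a bounded harmonic function of the random walk with the aperiodic step law
[p0].  Bounded harmonic sequences are constant ([harmonic_cst]), and then the
limit of [\sum_i r i * u (n - i) = 1] is [m0 * w = 1]
([renewal_ultralimit]).  So [u n] and [1 / m] have the same limit along [G],
which contradicts the choice of [G].

Constancy of [w] is a maximum principle.  If [p a > 0] and the increments
[d k = w k - w (k + a)] had a positive supremum [s], then an increment very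
close to [s] would force the next [d (k + i * a)] to be close to [s] too, and
the telescoping sum of many of them would exceed the bound of [w].  Hence
[w k <= w (k + a)], and the same for [1 - w]; so every point of the support of
[p] is a period of [w], and aperiodicity makes [1] a period.

Finally, [U_mu * h] is a sum of [u (n - k) * h k]; the terms with [k < K] are
controlled by the uniform convergence of [u] and the bound on the sums of
[|h k|], the others by the uniform smallness of the tails of these sums
([convolution_error]). *)

Set Implicit Arguments.
Unset Strict Implicit.
Unset Printing Implicit Defensive.

Local Open Scope classical_set_scope.
Local Open Scope ring_scope.

(** * Step laws on the natural numbers and their renewal sequences *)

Section renewal_sequences.
Variable R : realType.
Implicit Types (p u w : nat -> R).

Definition step_law p :=
  [/\ p 0%N = 0, forall k, 0 <= p k & series p @ \oo --> (1 : R)].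

Definition tail p (i : nat) : R := 1 - \sum_(k < i.+1) p k.

(** A mean is the sum of the tails, so this is the mean of [minn k N] under [p]. *)
Definition truncated_mean p (N : nat) : R := \sum_(i < N) tail p i.

Definition renewal_sequence p u :=
  u 0%N = 1 /\ forall n, u n.+1 = \sum_(i < n.+1) p i.+1 * u (n - i)%N.

Lemma tail0 p : step_law p -> tail p 0%N = 1.
Proof. by move=> [p0 _ _]; rewrite /tail big_ord1 p0 subr0. Qed.

Lemma tailS p i : tail p i.+1 = tail p i - p i.+1.
Proof. by rewrite /tail [in LHS]big_ord_recr /= opprD addrA. Qed.

Lemma tail_ge0 p i : step_law p -> 0 <= tail p i.
Proof.
move=> [_ p_ge0 p1]; rewrite subr_ge0 -(big_mkord xpredT p).
rewrite -(cvg_lim (@Rhausdorff R) p1).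
apply: (nondecreasing_cvgn_le _ _ i.+1); last by apply/cvg_ex; exists 1.
exact: nondecreasing_series.
Qed.

Lemma tail_cvg0 p : step_law p -> tail p @ \oo --> (0 : R).
Proof.
move=> [_ _ p1]; rewrite -[X in _ --> X](subrr (1 : R)).
apply: cvgB; first exact: cvg_cst.
have := p1; rewrite -(cvg_shiftS _) => H.
by apply: cvg_trans H; apply: near_eq_cvg; near=> n; rewrite /series /= big_mkord.
Unshelve. all: by end_near. Qed.

Lemma renewal_ge0 p u n : step_law p -> renewal_sequence p u -> 0 <= u n.
Proof.
move=> [_ p_ge0 _] [u0 uS]; elim/ltn_ind: n => -[|n] IH; first by rewrite u0.
by rewrite uS sumr_ge0// => i _; rewrite mulr_ge0// IH// ltnS leq_subr.
Qed.

(** The probability that the walk occupies some last point at or below [n]: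
[tail p i * u (n - i)] is the probability that this point is [n - i].
Algebraically, the sum is the same for [n] and [n.+1] because
[tail p i.+1 = tail p i - p i.+1]. *)
Lemma renewal_tail_sum p u n : step_law p -> renewal_sequence p u ->
  \sum_(i < n.+1) tail p i * u (n - i)%N = 1.
Proof.
move=> pP [u0 uS]; elim: n => [|n IH].
  by rewrite big_ord1 tail0// u0 mulr1.
rewrite big_ord_recl tail0// mul1r subn0 uS -[RHS]IH -big_split/=.
apply: eq_bigr => i _; rewrite /bump leq0n add1n subSS tailS; ring.
Qed.

Lemma renewal_le1 p u n : step_law p -> renewal_sequence p u -> u n <= 1.
Proof.
move=> pP uP; rewrite -(renewal_tail_sum n pP uP) big_ord_recl tail0// mul1r.
rewrite subn0 lerDl sumr_ge0// => i _.
by rewrite mulr_ge0 ?tail_ge0// (renewal_ge0 _ pP uP).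
Qed.

(** Cutting the renewal equation at [N] costs at most [tail p N], whatever [n] is;
only finite sums thus have to be passed to the limit. *)
Lemma renewal_step_truncation p u N n : step_law p -> renewal_sequence p u ->
  (N <= n.+1)%N ->
  0 <= u n.+1 - \sum_(i < N) p i.+1 * u (n - i)%N <= tail p N.
Proof.
move=> pP uP Nn; have [p0 p_ge0 _] := pP.
have -> : u n.+1 - \sum_(i < N) p i.+1 * u (n - i)%N =
    \sum_(N <= i < n.+1) p i.+1 * u (n - i)%N.
  rewrite uP.2 -(big_mkord xpredT (fun i => p i.+1 * u (n - i)%N)).
  rewrite -(big_mkord xpredT (fun i => p i.+1 * u (n - i)%N)).
  by rewrite (big_cat_nat (leq0n N) Nn)/= addrAC subrr add0r.
apply/andP; split.
  by apply: sumr_ge0 => i _; rewrite mulr_ge0// (renewal_ge0 _ pP uP).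
apply: (@le_trans _ _ (\sum_(N <= i < n.+1) p i.+1)).
  by apply: ler_sum => i _; rewrite ler_piMr// (renewal_le1 _ pP uP).
rewrite (_ : \sum_(N <= i < n.+1) p i.+1 = tail p N - tail p n.+1).
  by rewrite gerBl tail_ge0.
rewrite -[RHS]opprB -telescope_sumr// -sumrN; apply: eq_bigr => i _.
by rewrite tailS; ring.
Qed.

(** The analogous cut in [renewal_tail_sum]; its cost is a tail of the mean, which
uniform integrability makes uniformly small. *)
Lemma renewal_mean_truncation p u N n : step_law p -> renewal_sequence p u ->
  (N <= n.+1)%N ->
  0 <= 1 - \sum_(i < N) tail p i * u (n - i)%N <=
    truncated_mean p n.+1 - truncated_mean p N.
Proof.
move=> pP uP Nn; rewrite -{1 2}(renewal_tail_sum n pP uP).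
rewrite /truncated_mean -!(big_mkord xpredT (fun i => tail p i * u (n - i)%N)).
rewrite -!(big_mkord xpredT (fun i => tail p i)).
rewrite !(big_cat_nat (leq0n N) Nn)/= [X in X - _]addrC addrK.
rewrite [X in _ <= X - _]addrC addrK; apply/andP; split.
  by apply: sumr_ge0 => i _; rewrite mulr_ge0 ?tail_ge0// (renewal_ge0 _ pP uP).
apply: ler_sum => i _.
by rewrite ler_piMr ?tail_ge0// (renewal_le1 _ pP uP).
Qed.

(** Summation by parts. *)
Lemma truncated_meanE p N : step_law p ->
  truncated_mean p N =
    series (fun k => k%:R * p k) N + N%:R * (1 - series p N).
Proof.
move=> [p0 _ _]; elim: N => [|N IH].
  by rewrite /truncated_mean /series/= big_ord0 big_geq// mul0r addr0.
rewrite /truncated_mean big_ord_recr/= -/(truncated_mean p N) IH /tail.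
rewrite /series/= !big_nat_recr//= -(big_mkord xpredT p) big_nat_recr//=.
by rewrite -natr1; ring.
Qed.

Lemma truncated_mean_le p m N : step_law p ->
  series (fun k => k%:R * p k) @ \oo --> m -> truncated_mean p N <= m.
Proof.
move=> pP mP; have [_ p_ge0 p1] := pP; rewrite truncated_meanE//.
pose f K := series (fun k => k%:R * p k) N + N%:R * (series p K - series p N).
have fP : f K @[K --> \oo] -->
    series (fun k => k%:R * p k) N + N%:R * (1 - series p N).
  apply: cvgD; first exact: cvg_cst.
  by apply: cvgMr; apply: cvgB => //; exact: cvg_cst.
apply: ler_cvg_to fP mP _; exists N => // K /= NK.
rewrite /f /series/= !(big_cat_nat (leq0n N) NK)/= lerD2l addrAC subrr add0r mulr_sumr.
apply: ler_sum_nat => k /andP[Nk _].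
by rewrite ler_wpM2r// ler_nat.
Qed.

Lemma mean_le_truncated p m N (eps : R) : step_law p ->
  m <= series (fun k => k%:R * p k) N + eps -> m <= truncated_mean p N + eps.
Proof.
move=> pP /le_trans; apply; rewrite truncated_meanE// lerD2r lerDl.
rewrite mulr_ge0//; case: N => [|N]; first by rewrite /series/= big_geq// subr0.
by have := tail_ge0 N pP; rewrite /tail /series/= big_mkord.
Qed.

End renewal_sequences.

(** * Bounded harmonic sequences are constant *)

Section harmonic_sequences.
Variable R : realType.
Implicit Types (p w : nat -> R).

(** Harmonicity for a walk that moves by [+ i] with probability [p i]; the sequences
it is applied to are indexed backwards in time, which is why only indices above
[k] occur. *)
Definition harmonic_for p w :=
  forall k, series (fun i => p i * w (k + i)%N) @ \oo --> w k.

Lemma harmonic_cstB p w c : step_law p -> harmonic_for p w ->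
  harmonic_for p (fun k => c - w k).
Proof.
move=> [_ _ p1] wP k.
have -> : series (fun i => p i * (c - w (k + i)%N)) =
    (fun n => series p n * c - series (fun i => p i * w (k + i)%N) n).
  apply/funext => n; rewrite /series/= mulr_suml -sumrB.
  by apply: eq_bigr => i _; ring.
apply: cvgB; last exact: wP.
by rewrite -[X in _ --> X]mul1r; apply: cvgMl.
Qed.

Lemma harmonic_increment p w a : harmonic_for p w ->
  harmonic_for p (fun k => w k - w (k + a)%N).
Proof.
move=> wP k.
have -> : series (fun i => p i * (w (k + i)%N - w (k + i + a)%N)) =
    (fun n => series (fun i => p i * w (k + i)%N) n
              - series (fun i => p i * w (k + a + i)%N) n).
  apply/funext => n; rewrite /series/= -sumrB.
  by apply: eq_bigr => i _; rewrite mulrBr addnAC.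
by apply: cvgB; apply: wP.
Qed.

Lemma harmonic_ge_term p w k a : step_law p -> harmonic_for p w ->
  (forall k, 0 <= w k) -> p a * w (k + a)%N <= w k.
Proof.
move=> [_ p_ge0 _] wP w_ge0.
have t_ge0 i : 0 <= p i * w (k + i)%N by rewrite mulr_ge0.
apply: (@le_trans _ _ (series (fun i => p i * w (k + i)%N) a.+1)).
  by rewrite /series/= big_nat_recr//= lerDr sumr_ge0.
rewrite -(cvg_lim (@Rhausdorff R) (wP k)).
apply: nondecreasing_cvgn_le; last by apply/cvg_ex; exists (w k).
exact: nondecreasing_series.
Qed.

(** Applied to [s - d], where [s] bounds the harmonic sequence [d]: if [d k] is close
to its bound, so are the [d (k + i * a)] for [i <= n], with a loss that depends
only on [p a] and [n]. *)
Lemma harmonic_ge_iter p w k a n : step_law p -> harmonic_for p w ->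
  (forall k, 0 <= w k) -> p a ^+ n * w (k + n * a)%N <= w k.
Proof.
move=> pP wP w_ge0; elim: n => [|n IH]; first by rewrite mul1r addn0.
apply: le_trans IH; rewrite exprSr -mulrA ler_wpM2l ?exprn_ge0//.
  by have [] := pP.
by rewrite mulSnr addnA; exact: harmonic_ge_term.
Qed.

Lemma step_law_le1 p a : step_law p -> p a <= 1.
Proof.
move=> pP; have := tail_ge0 a pP; rewrite /tail big_ord_recr/= subr_ge0.
by apply: le_trans; rewrite lerDr sumr_ge0// => i _; have [] := pP.
Qed.

(** The maximum principle: a positive supremum of the increments
[w k - w (k + a)] would be nearly attained along an arbitrarily long
progression of step [a], whose increments add up to more than [1]. *)
Lemma harmonic_le_shift p w a : step_law p -> harmonic_for p w ->
  (forall k, 0 <= w k <= 1) -> 0 < p a -> forall k, w k <= w (k + a)%N.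
Proof.
move=> pP wP w01 pa k0; rewrite -subr_le0 leNgt; apply/negP => d_gt0.
pose d k := w k - w (k + a)%N.
have supD : has_sup (range d).
  split; first by exists (d k0), k0.
  exists 1 => _ [k _ <-]; rewrite /d.
  by have := w01 k; have := w01 (k + a)%N; lra.
pose s := sup (range d).
have d_le k : d k <= s by apply: ub_le_sup; [case: supD|exists k].
have s_gt0 : 0 < s by exact: lt_le_trans d_gt0 (d_le k0).
(* [n] increments of size at least [s / 2] add up to more than 1. *)
have [n n_gt] : exists n : nat, 2 / s < n%:R.
  by exists (Num.truncn (2 / s)).+1; exact: truncnS_gt.
have pan_gt0 m : 0 < p a ^+ m by rewrite exprn_gt0.
have [_ [k _ <-] dk] :
    exists2 x, range d x & s - p a ^+ n * (s / 2) < x.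
  by apply: sup_adherent => //; rewrite mulr_gt0// divr_gt0.
have dP : harmonic_for p (fun k => s - d k).
  exact: (harmonic_cstB pP (harmonic_increment wP)).
have dn i : (i < n)%N -> s / 2 <= d (k + i * a)%N.
  move=> i_n; have d0 j : 0 <= s - d j by rewrite subr_ge0.
  have := harmonic_ge_iter k a i pP dP d0.
  have : p a ^+ n * (s / 2) <= p a ^+ i * (s / 2).
    by rewrite ler_pM2r ?divr_gt0// ler_wiXn2l ?step_law_le1 ?(ltW pa)// ltnW.
  move=> h1 h2; have : p a ^+ i * (s - d (k + i * a)%N) <= p a ^+ i * (s / 2).
    lra.
  by rewrite ler_pM2l//; lra.
have : n%:R * (s / 2) <= w k - w (k + n * a)%N.
  have -> : w k - w (k + n * a)%N = \sum_(i < n) d (k + i * a)%N.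
    rewrite -[LHS]opprB -[X in - (_ - w X)]addn0 -(mul0n a).
    rewrite -(telescope_sumr (fun i => w (k + i * a)%N) (leq0n n)) big_mkord.
    rewrite -sumrN; apply: eq_bigr => i _.
    by rewrite /d opprB mulSnr addnA.
  rewrite -[n in n%:R]card_ord mulr_natl -sumr_const.
  by apply: ler_sum => i _; exact: dn.
have := w01 k; have := w01 (k + n * a)%N.
by rewrite ltr_pdivrMr// in n_gt; lra.
Qed.

Lemma harmonic_periodic p w a : step_law p -> harmonic_for p w ->
  (forall k, 0 <= w k <= 1) -> 0 < p a -> forall k, w (k + a)%N = w k.
Proof.
move=> pP wP w01 pa k; apply/le_anti/andP; split; last first.
  exact: harmonic_le_shift pP wP w01 pa k.
have := @harmonic_le_shift p (fun k => 1 - w k) a pP _ _ pa k.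
rewrite lerD2l lerN2; apply; first exact: harmonic_cstB.
by move=> j; have := w01 j; lra.
Qed.

Definition aperiodic p :=
  forall d : nat, (forall k, 0 < p k -> (d %| k)%N) -> d = 1%N.

(** The least positive period divides every period, hence the whole support of
[p]. *)
Lemma harmonic_cst p w : step_law p -> aperiodic p -> harmonic_for p w ->
  (forall k, 0 <= w k <= 1) -> forall k, w k = w 0%N.
Proof.
move=> pP pA wP w01.
pose period a := `[< (0 < a)%N /\ forall k, w (k + a)%N = w k >].
have [a pa] : exists a, 0 < p a.
  apply: contrapT => /forallNP p0; suff : 0%N = 1%N by [].
  by apply: pA => k /p0.
have suppP b : 0 < p b -> period b.
  move=> pb; apply/asboolP; split; last exact: harmonic_periodic pb.
  by case: b pb => //; have [-> _ _] := pP; rewrite ltxx.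
have exP : exists a, period a by exists a; exact: suppP.
case: (ex_minnP exP) => d /asboolP[d_gt0 dP] dmin.
have dmulP q k : w (k + q * d)%N = w k.
  by elim: q => [|q IH]; rewrite ?addn0// mulSnr addnA dP.
suff d1 : d = 1%N.
  by move=> k; rewrite -{1}(add0n k) -[in LHS](muln1 k) -d1 dmulP.
apply: pA => b /suppP/asboolP[_ bP]; rewrite /dvdn.
have [//|r_gt0] := posnP (b %% d)%N; have : period (b %% d)%N.
  apply/asboolP; split=> // k.
  by rewrite -(dmulP (b %/ d)%N) -addnA [(_ %% _ + _)%N]addnC -divn_eq bP.
by move=> /dmin; rewrite leqNgt ltn_pmod.
Qed.

End harmonic_sequences.

(** * The uniform renewal theorem for compact families *)

Section uniform_renewal.
Variable R : realType.

Lemma ultra_fmap (S T : Type) (f : S -> T) (F : set_system S) :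
  UltraFilter F -> UltraFilter (f @ F).
Proof.
move=> FU; split; first exact: fmap_proper_filter.
move=> G GF FG; rewrite eqEsubset; split=> // A GA.
have [//|FnA] := in_ultra_setVsetC (f @^-1` A) FU.
have /FG GnA : (f @ F) (~` A) by [].
have : G (A `&` ~` A) by exact: filterI.
by move=> /filter_ex[x []].
Qed.

Lemma ultra_bounded_cvg (T : Type) (F : set_system T) (x : T -> R) (a b : R) :
  UltraFilter F -> (\forall t \near F, a <= x t <= b) ->
  exists2 l, a <= l <= b & x @ F --> l.
Proof.
move=> FU xab; have := @segment_compact R a b; rewrite compact_ultra.
move=> /(_ (x @ F) (ultra_fmap x FU))[|l [/= lab xl]].
  by apply: filterS xab => t; rewrite /= in_itv.
by exists l => //; rewrite in_itv in lab.
Qed.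

Variables (T : Type) (M : set T) (p u : T -> nat -> R) (m : T -> R).
Hypothesis pP : forall t, M t -> step_law (p t).
Hypothesis uP : forall t, M t -> renewal_sequence (p t) (u t).
Hypothesis pA : forall t, M t -> aperiodic (p t).
Hypothesis m_ge : forall t N, M t -> truncated_mean (p t) N <= m t.
Hypothesis m_le : forall eps : R, 0 < eps ->
  exists N, forall t, M t -> m t <= truncated_mean (p t) N + eps.
Hypothesis MP : forall F : set_system T, UltraFilter F -> F M ->
  exists2 t0, M t0 & forall k, p t k @[t --> F] --> p t0 k.

Lemma mean_ge1 t : M t -> 1 <= m t.
Proof.
move=> Mt; have := m_ge 1 Mt; apply: le_trans.
by rewrite /truncated_mean big_ord1 tail0//; exact: pP.
Qed.

(** An ultrafilter on pairs of a time and a step law stands for a sequence of laws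
examined at times tending to infinity, along which every bounded quantity
converges. *)
Section limit.
Variable G : set_system (nat * T).
Context {GU : UltraFilter G}.
Hypothesis G_oo : forall N, \forall x \near G, (N <= x.1)%N.
Hypothesis G_M : \forall x \near G, M x.2.
Variable t0 : T.
Hypothesis Mt0 : M t0.
Hypothesis p_cvg : forall k, p x.2 k @[x --> G] --> p t0 k.

Lemma tail_cvg i : tail (p x.2) i @[x --> G] --> tail (p t0) i.
Proof.
apply: cvgB; first exact: cvg_cst.
by apply: cvg_big => [|k _]; [exact: add_continuous|exact: p_cvg].
Qed.

Lemma truncated_mean_cvg N :
  truncated_mean (p x.2) N @[x --> G] --> truncated_mean (p t0) N.
Proof.
by apply: cvg_big => [|k _]; [exact: add_continuous|exact: tail_cvg].
Qed.

Lemma mean_cvg : m x.2 @[x --> G] --> m t0.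
Proof.
apply/cvgrPdist_le => d d_gt0; have d4 : 0 < d / 4 by rewrite divr_gt0.
have [N mN] := m_le d4.
have /cvgrPdist_le/(_ _ d4) dT := @truncated_mean_cvg N.
apply: filterS2 G_M dT => x Mx.
have := m_ge N Mx; have := m_ge N Mt0; have := mN _ Mx; have := mN _ Mt0.
by rewrite !ler_norml; lra.
Qed.

(** The past of the renewal sequence seen from the time [x.1] converges to a harmonic
sequence for the limit law. *)
Lemma renewal_limit : exists w : nat -> R, [/\ forall k, 0 <= w k <= 1,
  forall k, u x.2 (x.1 - k)%N @[x --> G] --> w k &
  harmonic_for (p t0) w].
Proof.
have wE : forall k : nat, exists l : R,
    0 <= l <= 1 /\ u x.2 (x.1 - k)%N @[x --> G] --> l.
  move=> k; have [|l l01 ul] := @ultra_bounded_cvg _ G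
    (fun x => u x.2 (x.1 - k)%N) 0 1 GU; last by exists l.
  apply: filterS G_M => x Mx.
  by rewrite (renewal_ge0 _ (pP Mx) (uP Mx)) (renewal_le1 _ (pP Mx) (uP Mx)).
have [w wP] := choice wE.
have w01 k := (wP k).1; have w_cvg k := (wP k).2.
exists w; split=> // k; rewrite -cvg_shiftS.
have wB N : 0 <= w k - \sum_(i < N) p t0 i.+1 * w (k + i.+1)%N <= tail (p t0) N.
  have H : u x.2 (x.1 - k)%N - \sum_(i < N) p x.2 i.+1 * u x.2 (x.1 - (k + i.+1))%N
      @[x --> G] --> w k - \sum_(i < N) p t0 i.+1 * w (k + i.+1)%N.
    apply: cvgB => //; apply: cvg_big => [|i _]; first exact: add_continuous.
    exact: cvgM.
  have B : \forall x \near G, 0 <= u x.2 (x.1 - k)%N -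
      \sum_(i < N) p x.2 i.+1 * u x.2 (x.1 - (k + i.+1))%N <= tail (p x.2) N.
    near=> x.
    have Mx : M x.2 by near: x.
    have : (k + N.+1 <= x.1)%N by near: x; exact: G_oo.
    move=> kN; move: (kN); rewrite -leq_subRL; last first.
      by rewrite (leq_trans _ kN)// leq_addr.
    case E : (x.1 - k)%N => [//|n] Nn.
    rewrite (_ : \sum_(i < N) _ = \sum_(i < N) p x.2 i.+1 * u x.2 (n - i)%N).
      by apply: renewal_step_truncation; [exact: pP|exact: uP|exact: ltnW].
    by apply: eq_bigr => i _; rewrite subnDA E subSS.
  apply/andP; split.
    by apply: (cvgr_to_ge H); apply: filterS B => x /andP[].
  rewrite -subr_ge0; apply: (cvgr_to_ge (cvgB (@tail_cvg N) H)).
  by apply: filterS B => x /andP[_]; rewrite subr_ge0.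
have p00 : p t0 0%N = 0 by have [] := pP Mt0.
have -> : (fun n => series (fun i => p t0 i * w (k + i)%N) n.+1) =
    (fun N => \sum_(i < N) p t0 i.+1 * w (k + i.+1)%N).
  apply/funext => N; rewrite /series/= big_nat_recl// p00 mul0r add0r.
  by rewrite big_mkord.
apply/cvgrPdist_le => d d_gt0.
have [N _ NP] := (cvgrPdist_le _ _).1 (tail_cvg0 (pP Mt0)) _ d_gt0.
exists N => // n /NP /=; rewrite sub0r normrN => H.
have /andP[h1 h2] := wB n; rewrite ger0_norm//.
by apply: le_trans h2 _; apply: le_trans (ler_norm _) H.
Unshelve. all: by end_near. Qed.

(** The value of the constant [w] is read off from [renewal_tail_sum], whose limit is
[m t0 * w 0 = 1]. *)
Lemma renewal_ultralimit : u x.2 x.1 @[x --> G] --> (m t0)^-1.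
Proof.
have [w [w01 w_cvg wP]] := renewal_limit.
have w_cst := harmonic_cst (pP Mt0) (pA Mt0) wP w01.
have := w_cvg 0%N; under eq_fun do rewrite subn0.
suff -> : w 0%N = (m t0)^-1 by [].
have wB N (eps : R) : (forall t, M t -> m t <= truncated_mean (p t) N + eps) ->
    0 <= 1 - truncated_mean (p t0) N * w 0%N <= eps.
  move=> mN.
  have H : 1 - \sum_(i < N) tail (p x.2) i * u x.2 (x.1 - i)%N
      @[x --> G] --> 1 - truncated_mean (p t0) N * w 0%N.
    rewrite /truncated_mean mulr_suml; apply: cvgB; first exact: cvg_cst.
    apply: cvg_big => [|i _]; first exact: add_continuous.
    by rewrite -(w_cst i); apply: cvgM; [exact: tail_cvg|exact: w_cvg].
  have B : \forall x \near G,
      0 <= 1 - \sum_(i < N) tail (p x.2) i * u x.2 (x.1 - i)%N <= eps.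
    near=> x.
    have Mx : M x.2 by near: x.
    have Nx : (N <= x.1.+1)%N by apply: leqW; near: x; exact: G_oo.
    have /andP[-> /le_trans] := renewal_mean_truncation (pP Mx) (uP Mx) Nx.
    by apply; have := mN _ Mx; have := m_ge x.1.+1 Mx; lra.
  apply/andP; split.
    by apply: (cvgr_to_ge H); apply: filterS B => x /andP[].
  by apply: (cvgr_to_le H); apply: filterS B => x /andP[].
have w0 := w01 0%N.
suff mw1 : 1 - m t0 * w 0%N = 0.
  have m0 : m t0 != 0 by apply: lt0r_neq0; have := mean_ge1 Mt0; lra.
  have mw : m t0 * w 0%N = 1 by apply/esym/eqP; rewrite -subr_eq0 mw1.
  by rewrite -[LHS](mulKf m0) mw mulr1.
apply/eqP; rewrite -normr_le0; apply/ler_addgt0Pr => eps eps_gt0; rewrite add0r.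
have [N mN] := m_le eps_gt0; have := wB N _ mN.
have := m_ge N Mt0; have := mN _ Mt0; set A := truncated_mean _ _ => hA1 hA2 hw.
have epsw : eps * w 0%N <= eps by rewrite ler_piMr//; lra.
have h1 : A * w 0%N <= m t0 * w 0%N by rewrite ler_wpM2r//; lra.
have h2 : m t0 * w 0%N <= (A + eps) * w 0%N by rewrite ler_wpM2r//; lra.
by rewrite mulrDl in h2; rewrite ler_norml; lra.
Unshelve. all: by end_near. Qed.

End limit.

(** A failure of uniformity provides bad pairs with arbitrarily large times; these
generate a proper filter, and an ultrafilter containing it contradicts
[renewal_ultralimit]. *)
Theorem uniform_renewal (eps : R) : 0 < eps ->
  \forall n \near \oo, forall t, M t -> `|u t n - (m t)^-1| <= eps.
Proof.
move=> eps_gt0; apply: contrapT => nconv.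
pose B N := [set x : nat * T |
  [/\ (N <= x.1)%N, M x.2 & eps < `|u x.2 x.1 - (m x.2)^-1|]].
have FB : ProperFilter (filter_from setT B).
  apply: filter_from_proper; last first.
    move=> N _; apply: contrapT => B0; apply: nconv; exists N => // n Nn t Mt.
    by rewrite leNgt; apply/negP => h; apply: B0; exists (n, t).
  apply: filter_from_filter; first by exists 0%N.
  move=> i j _ _; exists (maxn i j) => // x [].
  by rewrite geq_max => /andP[ix jx] Mx hx; split.
have [G [GU BG]] := ultraFilterLemma FB.
have GB N : G (B N) by apply: BG; exists N.
have G_oo N : \forall x \near G, (N <= x.1)%N by apply: filterS (GB N) => x [].
have G_M : \forall x \near G, M x.2 by apply: filterS (GB 0%N) => x [].
have [t0 Mt0 p_cvg] := MP (ultra_fmap snd GU) G_M.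
have u_cvg := @renewal_ultralimit G GU G_oo G_M t0 Mt0 p_cvg.
have m_cvg := @mean_cvg G GU G_M t0 Mt0 p_cvg.
have m0 : m t0 != 0 by apply: lt0r_neq0; have := mean_ge1 Mt0; lra.
have /cvgrPdist_le/(_ _ eps_gt0) H :
    u x.2 x.1 - (m x.2)^-1 @[x --> G] --> (0 : R).
  by rewrite -(subrr (m t0)^-1); exact: cvgB u_cvg (cvgV m0 m_cvg).
have : G ((fun x => `|0 - (u x.2 x.1 - (m x.2)^-1)| <= eps) `&` B 0%N).
  exact: filterI H (GB 0%N).
move=> /filter_ex[x [/=]].
by rewrite sub0r normrN => /le_lt_trans + [_ _] => /[apply]; rewrite ltxx.
Qed.

End uniform_renewal.

(** * Measures carried by the lattice *)

Section arithmetic_laws.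
Variables (R : realType) (delta : R).
Implicit Type mu : real_probability R.

Definition lattice_weight mu (k : nat) : R := fine (mu [set k%:R * delta]).

Definition positive_lattice : set (measurableTypeR R) :=
  [set k.+1%:R * delta | k in [set: nat]].

Lemma positive_latticeE :
  positive_lattice = [set k%:R * delta | k in [set k | (0 < k)%N]].
Proof.
apply/seteqP; split=> x [k]; first by move=> _ <-; exists k.+1.
by case: k => // k _ <-; exists k.
Qed.

Hypothesis delta_gt0 : 0 < delta.

Lemma measurable_lattice_image (I : set nat) (g : nat -> R) :
  measurable ([set g k | k in I] : set (measurableTypeR R)).
Proof.
rewrite (_ : [set g k | k in I] = \bigcup_(k in I) [set g k]); last first.
  by apply/seteqP; split=> x [k Ik xE]; exists k.
by apply: bigcup_measurable => k _; exact: measurable_set1.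
Qed.

Lemma span_lattice mu : Span mu = delta -> mu positive_lattice = 1%E.
Proof.
move=> spanE; have [[_ //]|/= d0] : span_candidates mu delta.
  move: delta_gt0; rewrite -spanE /Span.
  by case: xgetP => [d _ [//]|_]; rewrite ltxx.
by move: delta_gt0; rewrite d0 ltxx.
Qed.

Lemma lattice_point_inj (i j : nat) : i%:R * delta = j%:R * delta -> i = j.
Proof. by move/(mulIf (lt0r_neq0 delta_gt0))/eqP; rewrite eqr_nat => /eqP. Qed.

Section one_law.
Variable mu : real_probability R.
Hypothesis muP : mu positive_lattice = 1%E.
Notation p := (lattice_weight mu).

Lemma positive_lattice_ae : \forall x \ae mu, positive_lattice x.
Proof.
have mL : measurable positive_lattice by exact: measurable_lattice_image.
exists (~` positive_lattice); split=> //; first exact: measurableC.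
by rewrite probability_setC// muP subee.
Qed.

Lemma lattice_weightE k : mu [set k%:R * delta] = (p k)%:E.
Proof. by rewrite fineK// fin_num_measure. Qed.

Lemma lattice_weight_ge0 k : 0 <= p k.
Proof. by rewrite fine_ge0. Qed.

Lemma measure_off_lattice x : ~ positive_lattice x -> mu [set x] = 0%E.
Proof.
move=> nx; apply: measure_negligible => //.
by apply: negligibleS positive_lattice_ae => y /= ->.
Qed.

Lemma measure_sub_lattice (I : set nat) :
  mu [set k%:R * delta | k in I] = (\sum_(k <oo | k \in I) (p k)%:E)%E.
Proof.
rewrite (_ : [set _ | _ in I] = \bigcup_(k in I) [set k%:R * delta]); last first.
  by apply/seteqP; split=> x [k Ik xE]; exists k.
rewrite measure_bigcup//; last first.
  apply/trivIsetP => i j _ _ ij; rewrite -subset0 => x.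
  by move=> [/= -> /lattice_point_inj/eqP]; rewrite (negPf ij).
by apply: eq_eseriesr => k _; exact: lattice_weightE.
Qed.

Lemma lattice_weight0 : p 0%N = 0.
Proof.
rewrite /lattice_weight measure_off_lattice// => -[k _] /lattice_point_inj.
by [].
Qed.

Lemma lattice_weight_step_law : step_law p.
Proof.
split; [exact: lattice_weight0|exact: lattice_weight_ge0|].
have sum1 : (\sum_(k <oo) (p k)%:E)%E = 1%E.
  rewrite -muP positive_latticeE measure_sub_lattice [RHS]eseries_mkcond.
  apply: eq_eseriesr => k _; case: ifPn => //.
  rewrite notin_setE /= => /negP; rewrite -leqNgt leqn0.
  by move=> /eqP ->; rewrite lattice_weight0.
have c : (\sum_(0 <= k < n) (p k)%:E)%E @[n --> \oo] --> (1%:E : \bar R).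
  by rewrite -sum1; apply: is_cvg_nneseries => k _ _; rewrite lee_fin lattice_weight_ge0.
rewrite (_ : series p = fine \o (fun n => \sum_(0 <= k < n) (p k)%:E)%E).
  exact: fine_cvg.
by apply/funext => n; rewrite /= sumEFin.
Qed.

Lemma lattice_weight_support (I : set nat) :
  (forall k, 0 < p k -> I k) -> mu [set k%:R * delta | k in I] = 1%E.
Proof.
move=> pI.
rewrite -muP positive_latticeE !measure_sub_lattice.
rewrite [LHS]eseries_mkcond [RHS]eseries_mkcond.
apply: eq_eseriesr => k _; have [pk|pk] := ltP 0 (p k).
  rewrite !mem_set//=; last exact: pI.
  by rewrite lt0n; apply/eqP => k0; move: pk; rewrite k0 lattice_weight0 ltxx.
have -> : p k = 0 by apply/le_anti; rewrite pk lattice_weight_ge0.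
by rewrite !if_same.
Qed.

(** If [d] divides the support then [d * delta] is a candidate for the span, and
[delta] is the largest one. *)
Lemma lattice_weight_aperiodic : Span mu = delta -> aperiodic p.
Proof.
move=> spanE d dP.
have d_gt0 : (0 < d)%N.
  rewrite lt0n; apply/eqP => d0.
  have [p0 p_ge0 p1] := lattice_weight_step_law.
  have pE : series p = cst 0.
    apply/funext => n; rewrite /series/= big1// => k _.
    apply/eqP; rewrite eq_le p_ge0 leNgt andbT; apply/negP => pk.
    have := dP k pk; rewrite d0 dvd0n => /eqP k0.
    by move: pk; rewrite k0 p0 ltxx.
  move: p1; rewrite pE => /(cvg_unique (@Rhausdorff R))/(_ (cvg_cst _))/eqP.
  by rewrite oner_eq0.
have : span_candidates mu (d%:R * delta).
  left; split; first by rewrite mulr_gt0// ltr0n.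
  rewrite -(@lattice_weight_support [set k | (0 < k)%N /\ (d %| k)%N]).
    congr (mu _); apply/seteqP; split=> x /=.
      move=> [k _ <-]; exists (k.+1 * d)%N.
        by rewrite muln_gt0/= d_gt0 dvdn_mull.
      by rewrite natrM mulrA.
    move=> [k [k_gt0 /dvdnP[[|q] kE]] <-]; first by rewrite kE in k_gt0.
    by exists q => //; rewrite kE natrM mulrA.
  move=> k pk; split; last exact: dP.
  by rewrite lt0n; apply/eqP => k0; move: pk; rewrite k0 lattice_weight0 ltxx.
have : ubound (span_candidates mu) delta.
  move: delta_gt0; rewrite -spanE /Span.
  by case: xgetP => [x _ [//]|_]; rewrite ltxx.
move=> /[apply]; rewrite ger_pMl// (ler_nat R d 1) => d1.
by apply/eqP; rewrite eqn_leq d1.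
Qed.



Lemma convolution_point (nu : real_probability R) (y : R) :
  convolution mu nu [set y] = (\int[mu]_x nu [set (y - x)%R])%E.
Proof.
rewrite /convolution/= /distribution /pushforward /= /product_measure1.
apply: eq_integral => x _ /=; congr (nu _).
apply/seteqP; split=> z /=; rewrite /xsection /=.
  by move=> /set_mem/= <-; rewrite /radd /= addrAC subrr add0r.
by move=> ->; apply/mem_set; rewrite /= /radd /= addrC subrK.
Qed.


(** Nonnegativity is asked for on the lattice only, so that this applies to the
identity function. *)
Lemma integral_lattice (g : measurableTypeR R -> \bar R) :
  measurable_fun setT g -> (forall k, 0 <= g (k%:R * delta)%R)%E ->
  (\int[mu]_x g x = \sum_(k <oo) g (k%:R * delta)%R * (p k)%:E)%E.
Proof.
move=> mg g_ge0; pose L : set (measurableTypeR R) := \bigcup_k [set k%:R * delta].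
have mL : measurable L by apply: bigcupT_measurable => k; exact: measurable_set1.
transitivity (\int[mu]_x maxe (g x) 0)%E.
  apply: ae_eq_integral => //; first exact: measurable_maxe.
  apply: filterS positive_lattice_ae => x [k _ <-] _.
  by rewrite max_l.
have mg' : measurable_fun setT (fun x => maxe (g x) 0) by exact: measurable_maxe.
rewrite (ge0_negligible_integral (N := ~` L))//; last 3 first.
- exact: measurableC.
- by move=> x _; rewrite le_max lexx orbT.
- apply: measure_negligible; first exact: measurableC.
  apply: negligibleS positive_lattice_ae => x /= nLx [k _ xE].
  by apply: nLx; exists k.+1.
rewrite setTD setCK ge0_integral_bigcup//; last 3 first.
- exact: measurable_funS mg'.
- by move=> x _; rewrite le_max lexx orbT.
- apply/trivIsetP => i j _ _ ij; rewrite -subset0.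
  by move=> x [/= -> /lattice_point_inj/eqP]; rewrite (negPf ij).
apply: eq_eseriesr => k _.
rewrite (eq_integral (cst (g (k%:R * delta)))); last first.
  by move=> x /set_mem/= ->; rewrite max_l.
by rewrite integral_cst//= lattice_weightE.
Qed.

Lemma mean_lattice :
  (\int[mu]_t t%:E = \sum_(k <oo) (delta * (k%:R * p k))%:E)%E.
Proof.
rewrite integral_lattice//; last by move=> k; rewrite lee_fin mulr_ge0// ltW.
by apply: eq_eseriesr => k _; rewrite -EFinM mulrCA mulrA.
Qed.

Lemma tail_mean_lattice N :
  (\sum_(N <= k <oo) (delta * (k%:R * p k))%:E <=
   \int[mu]_(t in `[(N%:R * delta)%R, +oo[) t%:E)%E.
Proof.
rewrite integral_mkcond integral_lattice; last 2 first.
- by apply/(measurable_restrictT _ _).1 => //.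
- move=> k; rewrite patchE; case: ifP => // _.
  by rewrite lee_fin mulr_ge0// ltW.
rewrite eseries_cond eseries_mkcond; apply: lee_nneseries => k _ /=.
  by case: ifP => // _; rewrite lee_fin !mulr_ge0 ?lattice_weight_ge0// ltW.
case: ifP => Nk.
  rewrite patchE mem_set; first by rewrite -EFinM mulrCA mulrA.
  by rewrite /= in_itv/= andbT ler_pM2r// ler_nat.
rewrite mule_ge0// ?lee_fin ?lattice_weight_ge0// patchE; case: ifP => // _.
by rewrite lee_fin mulr_ge0// ltW.
Qed.

(** The mean in units of [delta] is introduced through its inverse
[delta * renewal_rate mu]; that it is finite comes from the bound on the tail
of the mean. *)
Lemma mean_lattice_le N (eps : R) :
  (\int[mu]_(t in `[(N%:R * delta)%R, +oo[) t%:E <= (delta * eps)%:E)%E ->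
  exists m, [/\ delta * renewal_rate mu = m^-1,
    forall K, truncated_mean p K <= m & m <= truncated_mean p N + eps].
Proof.
move=> epsP; have pP := lattice_weight_step_law.
have t_ge0 k : (0 <= (delta * (k%:R * p k))%:E)%E.
  by rewrite lee_fin !mulr_ge0 ?lattice_weight_ge0// ltW.
pose E := (\int[mu]_t t%:E)%E.
have EE : E = (\sum_(k <oo) (delta * (k%:R * p k))%:E)%E := mean_lattice.
have Ele : (E <= (delta * (series (fun k => k%:R * p k) N + eps))%:E)%E.
  rewrite EE (nneseries_split 0 N)//= add0n sumEFin mulrDr EFinD.
  rewrite /series/= mulr_sumr leeD2l//.
  exact: le_trans (tail_mean_lattice N) epsP.
have Efin : E \is a fin_num.
  rewrite ge0_fin_numE; first exact: le_lt_trans Ele (ltry _).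
  by rewrite EE; apply: nneseries_ge0.
exists (fine E / delta).
have m_cvg : series (fun k => k%:R * p k) @ \oo --> fine E / delta.
  have c : (\sum_(0 <= k < n) (delta * (k%:R * p k))%:E)%E @[n --> \oo] -->
      (fine E)%:E.
    by rewrite fineK// EE; apply: is_cvg_nneseries.
  rewrite (_ : series _ = fun n =>
      fine (\sum_(0 <= k < n) (delta * (k%:R * p k))%:E)%E / delta).
    by apply: cvgMl; exact: fine_cvg c.
  apply/funext => n; rewrite sumEFin/= -mulr_sumr mulrAC mulfV ?mul1r//.
  exact: lt0r_neq0.
split.
- by rewrite /renewal_rate invf_div mulrC.
- by move=> K; exact: truncated_mean_le.
- apply: mean_le_truncated => //; rewrite ler_pdivrMr// mulrC.
  by rewrite -lee_fin fineK.
Qed.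

End one_law.
End arithmetic_laws.

(** * The renewal measure of a lattice law *)

Section renewal_of_measure.
Variables (R : realType) (delta : R).
Hypothesis delta_gt0 : 0 < delta.
Variable mu : real_probability R.
Hypothesis muP : mu (positive_lattice delta) = 1%E.
Notation p := (lattice_weight delta mu).

Lemma convolution_lattice (nu : real_probability R) (y : R) :
  (convolution mu nu [set y] =
   \sum_(k <oo) nu [set (y - k%:R * delta)%R] * (p k)%:E)%E.
Proof.
rewrite convolution_point (@integral_lattice R delta)//.
have mS : measurable ((radd (R := R)) @^-1` [set y]).
  by rewrite -[X in measurable X]setTI; apply: measurable_radd => //; exact: measurable_set1.
have := measurable_fun_xsection nu mS.
apply: eq_measurable_fun => x _ /=; congr (nu _).
apply/seteqP; split=> z /=; rewrite /xsection /=.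
  by move=> /set_mem/= <-; rewrite /radd /= addrAC subrr add0r.
by move=> ->; apply/mem_set; rewrite /= /radd /= addrC subrK.
Qed.

(** This is what makes the convolution at [k * delta] a sum over [i <= k] only. *)
Lemma convolution_power_neg n (y : R) : y < 0 ->
  convolution_power mu n [set y] = 0%E.
Proof.
elim: n y => [|n IH] y y_lt0.
  by rewrite /= diracE memNset//= => y0; rewrite -y0 ltxx in y_lt0.
rewrite [convolution_power _ _]/(convolution mu (convolution_power mu n)).
rewrite convolution_lattice; apply: eseries0 => k _ _.
by rewrite IH ?mul0e// subr_lt0 (lt_le_trans y_lt0)// mulr_ge0 ?(ltW delta_gt0).
Qed.

Lemma convolution_power_point n k :
  (convolution_power mu n.+1 [set (k%:R * delta)%R] =
   \sum_(i < k.+1) (p i)%:E * convolution_power mu n [set ((k - i)%:R * delta)%R])%E.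
Proof.
rewrite [convolution_power _ n.+1]/(convolution mu (convolution_power mu n)).
rewrite convolution_lattice (nneseries_split 0 k.+1)/=; last first.
  by move=> i _; rewrite mule_ge0// lee_fin lattice_weight_ge0.
rewrite [X in (_ + X)%E]eseries0 ?adde0; last first.
  move=> i; rewrite add0n => ki _; rewrite convolution_power_neg ?mul0e//.
  by rewrite -mulrBl pmulr_llt0// subr_lt0 ltr_nat.
rewrite add0n big_mkord; apply: eq_bigr => i _.
by rewrite muleC natrB ?mulrBl// -ltnS.
Qed.

Lemma renewal_measure_point k :
  (renewal_measure mu [set (k%:R * delta)%R] = (k == 0%N)%:R%:E +
   \sum_(i < k.+1) (p i)%:E * renewal_measure mu [set ((k - i)%:R * delta)%R])%E.
Proof.
rewrite /renewal_measure /= /mseries nneseries_recl//; congr (_ + _)%E.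
  rewrite /= diracE; congr ((nat_of_bool _)%:R%:E); apply/idP/eqP => [/set_mem/=/eqP|->].
    by rewrite eq_sym mulf_eq0 (gt_eqF delta_gt0) orbF pnatr_eq0 => /eqP ->.
  by rewrite mul0r mem_set.
rewrite -nneseries_addn//.
transitivity (\sum_(j <oo) \sum_(i < k.+1)
    (p i)%:E * convolution_power mu j [set ((k - i)%:R * delta)%R])%E.
  by apply: eq_eseriesr => j _; rewrite addn1; exact: convolution_power_point.
rewrite nneseries_sum//; last first.
  by move=> i j _; rewrite mule_ge0// lee_fin lattice_weight_ge0.
by apply: eq_bigr => i _; rewrite nneseriesZl.
Qed.

(** Finiteness is proved along with the recursion: [p 0 = 0], so each value is a finite
combination of earlier ones. *)
Lemma renewal_measure_sequence :
  (forall k, renewal_measure mu [set (k%:R * delta)%R] \is a fin_num) /\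
  renewal_sequence p
    (fun k => fine (renewal_measure mu [set k%:R * delta])).
Proof.
pose U k : \bar R := renewal_measure mu [set k%:R * delta].
have p0 : p 0%N = 0 by exact: lattice_weight0.
have U0 : U 0%N = 1%E.
  by rewrite /U renewal_measure_point/= big_ord1 p0 mul0e adde0.
have US n : U n.+1 = (\sum_(i < n.+1) (p i.+1)%:E * U (n - i)%N)%E.
  by rewrite /U renewal_measure_point/= big_ord_recl p0 mul0e !add0e.
have Ufin k : U k \is a fin_num.
  elim/ltn_ind: k => -[|n] IH; first by rewrite U0.
  by rewrite US; apply/sum_fin_numP => i _ _; rewrite fin_numM// IH// ltnS leq_subr.
split=> //; split; first by rewrite -/(U 0%N) U0.
move=> n; apply: EFin_inj; rewrite -/(U n.+1) fineK// US -sumEFin.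
by apply: eq_bigr => i _; rewrite EFinM -/(U (n - i)%N) (fineK (Ufin _)).
Qed.

End renewal_of_measure.

(** * Weak limits of lattice laws *)

Section weak_limits.
Variables (R : realType) (delta : R).
Hypothesis delta_gt0 : 0 < delta.

(** A bounded continuous function that takes the value 1 at [k * delta] and vanishes
at all other lattice points. *)
Definition tent (k : nat) (x : R) : R :=
  Num.max 0 (1 - `|x / delta - k%:R|).

Lemma tent_continuous k : continuous (tent k).
Proof.
move=> x; apply: (@continuous_max R R (cst 0) (fun y => 1 - `|y / delta - k%:R|) x).
  exact: cvg_cst.
apply: cvgB; first exact: cvg_cst.
apply: cvg_norm; apply: cvgB; last exact: cvg_cst.
by apply: cvgMl; exact: cvg_id.
Qed.

Lemma tent_ge0 k x : 0 <= tent k x.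
Proof. by rewrite /tent le_max lexx. Qed.

Lemma tent_bounded k : bounded_fun (tent k).
Proof.
exists 1; split=> // r r_gt1 x _ /=; apply: le_trans (ltW r_gt1).
rewrite ger0_norm ?tent_ge0//.
by rewrite /tent ge_max ler01 gerBl normr_ge0.
Qed.

Lemma tent_lattice k i : tent k (i%:R * delta) = (i == k)%:R.
Proof.
rewrite /tent mulfK ?lt0r_neq0//; have [->|ik] := eqVneq i k.
  by rewrite subrr normr0 subr0 max_r.
rewrite max_l// subr_le0; have [ik'|] := ltnP k i.
  by rewrite ger0_norm -?natrB ?ler1n ?subn_gt0 ?ler0n// ltnW.
rewrite leq_eqVlt (negPf ik)/= => ki.
by rewrite distrC ger0_norm -?natrB ?ler1n ?subn_gt0 ?ler0n// ltnW.
Qed.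

Definition bc_tent k : bounded_continuous R :=
  BoundedContinuous (@tent_continuous k) (@tent_bounded k).

Lemma bc_integral_tent (mu : real_probability R) k : mu (positive_lattice delta) = 1%E ->
  bc_integral mu (bc_tent k) = lattice_weight delta mu k.
Proof.
move=> muP; rewrite /bc_integral /Rintegral /= (@integral_lattice R delta)//; last 2 first.
- by apply/measurable_EFinP; apply: continuous_measurable_fun; exact: tent_continuous.
- by move=> i; rewrite lee_fin tent_ge0.
rewrite (nneseriesD1 (n := k))//; last first.
  by move=> i _; rewrite mule_ge0// lee_fin ?tent_ge0 ?lattice_weight_ge0.
rewrite eseries0 ?adde0 ?tent_lattice ?eqxx ?mul1e// => i _ /= ik.
by rewrite tent_lattice (negPf ik) mul0e.
Qed.

Lemma weak_compact_weights (M : set (real_probability R))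
    (F : set_system (real_probability R)) :
  (forall mu, M mu -> mu (positive_lattice delta) = 1%E) ->
  compact (M : set (weak_probability R)) -> UltraFilter F -> F M ->
  exists2 mu0, M mu0 & forall k,
    lattice_weight delta mu k @[mu --> F] --> lattice_weight delta mu0 k.
Proof.
move=> MP; rewrite compact_ultra => cM FU FM.
have [mu0 [Mmu0 Fmu0]] := cM F FU FM.
exists mu0 => // k.
have bcP : continuous (fun mu : weak_probability R => bc_integral mu (bc_tent k)).
  move=> mu; apply: (@continuous_comp (weak_probability R) _ _ (@bc_integral R)
    (@proj _ (fun=> R) (bc_tent k))).
    exact: initial_continuous.
  exact: proj_continuous.
rewrite -(bc_integral_tent k (MP _ Mmu0)).
have := cvg_trans (cvg_app _ Fmu0) (bcP mu0); apply: cvg_trans.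
by apply: near_eq_cvg; apply: filterS FM => mu /MP muP; exact: bc_integral_tent.
Qed.

End weak_limits.

(** * Convolution with a summable sequence *)

Section convolution_bound.
Variable R : realType.

(** The three terms come from [k < K], where [u (n - k)] is close to [c]; from
[K <= k <= n], where only [|u - c| <= 1] is used; and from the part of the
series of [h] beyond [n]. *)
Lemma convolution_error (u h : nat -> R) (c B eta tau : R) (K N n : nat) :
  (forall j, 0 <= u j <= 1) -> 0 <= c <= 1 ->
  (forall j, (N <= j)%N -> `|u j - c| <= eta) ->
  (forall j, \sum_(0 <= k < j) `|h k| <= B) ->
  (forall j, \sum_(K <= k < j) `|h k| <= tau) ->
  (K + N <= n)%N ->
  `|\sum_(0 <= k < n.+1) u (n - k)%N * h k - c * limn (series h)|
    <= eta * B + tau + tau.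
Proof.
move=> u01 c01 uc hB htau KNn.
have eta_ge0 : 0 <= eta by apply: le_trans (uc N (leqnn _)).
have hcvg : series h @ \oo --> limn (series h).
  apply: normed_cvg; apply: nondecreasing_is_cvgn.
    by apply: (@nondecreasing_series R (fun k => `|h k|) xpredT 0%N).
  by exists B => _ [j _ <-]; exact: hB.
have Kn : (K <= n.+1)%N by rewrite (leq_trans _ (leqW KNn))// leq_addr.
have tailh : `|limn (series h) - series h n.+1| <= tau.
  have dcvg : `|series h j - series h n.+1| @[j --> \oo] -->
      `|limn (series h) - series h n.+1|.
    by apply: cvg_norm; apply: cvgB; [exact: hcvg|exact: cvg_cst].
  apply: (cvgr_to_le dcvg); exists n.+1 => // j /= nj.
  rewrite /series/= (big_cat_nat (leq0n _) nj)/=.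
  rewrite addrAC subrr add0r; apply: le_trans (ler_norm_sum _ _ _) _.
  apply: le_trans (htau j); rewrite [leRHS](big_cat_nat Kn nj)/= lerDr.
  exact: sumr_ge0.
have -> : \sum_(0 <= k < n.+1) u (n - k)%N * h k - c * limn (series h) =
    \sum_(0 <= k < n.+1) (u (n - k)%N - c) * h k
      - c * (limn (series h) - series h n.+1).
  have -> : \sum_(0 <= k < n.+1) u (n - k)%N * h k =
      \sum_(0 <= k < n.+1) (u (n - k)%N - c) * h k + c * series h n.+1.
    rewrite /series/= mulr_sumr -big_split/=.
    by apply: eq_bigr => k _; ring.
  by ring.
apply: le_trans (ler_normB _ _) _; apply: lerD; last first.
  rewrite normrM ger0_norm; last by case/andP: c01.
  by apply: le_trans tailh; rewrite ler_piMl//; case/andP: c01.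
rewrite (big_cat_nat (leq0n _) Kn)/=.
apply: le_trans (ler_normD _ _) _; apply: lerD.
  apply: (@le_trans _ _ (eta * \sum_(0 <= k < K) `|h k|)).
    apply: le_trans (ler_norm_sum _ _ _) _; rewrite mulr_sumr.
    apply: ler_sum_nat => k /andP[_ kK]; rewrite normrM ler_wpM2r//.
    apply: uc; rewrite leq_subRL; last first.
      by rewrite (leq_trans (ltnW kK))// (leq_trans _ KNn)// leq_addr.
    by rewrite (leq_trans _ KNn)// leq_add2r ltnW.
  by rewrite ler_wpM2l.
apply: le_trans (ler_norm_sum _ _ _) _; apply: le_trans (htau n.+1).
apply: ler_sum_nat => k _; rewrite normrM ler_piMl//.
by have := u01 (n - k)%N; move: c01; rewrite ler_norml; lra.
Qed.

End convolution_bound.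

(** * The uniform renewal theorem for lattice measures *)

Section uniform_renewal_theorem.
Variables (R : realType) (delta : R) (M : set (real_probability R)).
Hypothesis delta_gt0 : 0 < delta.
Hypothesis M_compact : compact (M : set (weak_probability R)).
Hypothesis M_span : forall mu, M mu -> Span mu = delta.
Hypothesis M_ui : uniformly_integrable M.

Lemma uniform_tail_mean (eps : R) : 0 < eps -> exists N, forall mu, M mu ->
  (\int[mu]_(t in `[(N%:R * delta)%R, +oo[) t%:E <= (delta * eps)%:E)%E.
Proof.
move=> eps_gt0.
have /M_ui[A [_ AP]] : nbhs (0%E : \bar R) [set y | (y < (delta * eps)%:E)%E].
  by apply: open_ereal_lt'; rewrite lte_fin mulr_gt0.
exists (Num.truncn (A / delta)).+1 => mu Mmu.
have : A < (Num.truncn (A / delta)).+1%:R * delta.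
  by rewrite -ltr_pdivrMr// truncnS_gt.
move=> /AP/= /ltW; apply: le_trans.
by apply: ereal_sup_ubound; exists mu.
Qed.

Lemma uniform_renewal_measure (eps : R) : 0 < eps ->
  \forall n \near \oo, forall mu, M mu ->
    `|fine (renewal_measure mu [set n%:R * delta]) - delta * renewal_rate mu|
      <= eps.
Proof.
move=> eps_gt0.
have MP mu : M mu -> mu (positive_lattice delta) = 1%E.
  by move=> Mmu; apply: span_lattice => //; exact: M_span.
have mM (e : R) : 0 < e -> exists N, forall mu, M mu ->
    (forall K, truncated_mean (lattice_weight delta mu) K <=
       (delta * renewal_rate mu)^-1) /\
    (delta * renewal_rate mu)^-1 <= truncated_mean (lattice_weight delta mu) N + e.
  move=> e_gt0; have [N NP] := uniform_tail_mean e_gt0; exists N => mu Mmu.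
  have [m [-> h1 h2]] := mean_lattice_le delta_gt0 (MP _ Mmu) (NP _ Mmu).
  by rewrite invrK.
have := @uniform_renewal R (real_probability R) M (lattice_weight delta)
  (fun mu n => fine (renewal_measure mu [set n%:R * delta]))
  (fun mu => (delta * renewal_rate mu)^-1) _ _ _ _ _ _ eps eps_gt0.
under [in X in _ -> X]eq_near do under eq_forall do rewrite -[delta * _]invrK.
apply.
- by move=> mu /MP; exact: lattice_weight_step_law.
- by move=> mu /MP muP; exact: (renewal_measure_sequence delta_gt0 muP).2.
- by move=> mu Mmu; apply: lattice_weight_aperiodic => //; [exact: MP|exact: M_span].
- by move=> mu K Mmu; have [N /(_ _ Mmu)[]] := mM 1 ltr01.
- by move=> e /mM[N NP]; exists N => mu /NP[].
- by move=> F FU FM; exact: weak_compact_weights.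
Qed.

End uniform_renewal_theorem.

Lemma lattice_abs_tail_bound (R : realType) (delta : R) (h : lattice delta -> R)
    (K j : nat) (b : R) : (lattice_abs_tail h K <= b%:E)%E ->
  \sum_(K <= k < j) `|h (lattice_point delta k)| <= b.
Proof.
move=> hb; rewrite -lee_fin -sumEFin; apply: le_trans hb.
by apply: nneseries_lim_ge => k _ _; rewrite lee_fin.
Qed.

Theorem theorem1p5 (R : realType) (delta : R)
    (M : set (real_probability R)) (H : set (lattice delta -> R)) :
  0 < delta ->
  (forall mu, M mu -> mu `]0, +oo[%classic = 1%E) ->
  compact (M : set (weak_probability R)) ->
  (forall mu, M mu -> Span mu = delta) ->
  uniformly_integrable M ->
  (ereal_sup [set lattice_abs_tail h 0 | h in H] < +oo)%E ->
  (ereal_sup [set lattice_abs_tail h n | h in H] @[n --> \oo] --> 0)%E ->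
  {uniform M `*` H,
    (fun (n : nat) (mh : real_probability R * (lattice delta -> R)) =>
       lattice_convolution (renewal_measure mh.1) mh.2 n) @ \oo
    --> (fun mh : real_probability R * (lattice delta -> R) =>
       delta * renewal_rate mh.1 * lattice_sum mh.2)}.
Proof.
move=> delta_gt0 _ M_compact M_span M_ui H_sum H_tail P /uniform_nbhs[E [entE EP]].
have [eps /= eps_gt0 epsE] : exists2 eps : R, 0 < eps &
    forall x y : R, `|x - y| < eps -> E (x, y).
  have := entE; rewrite -entourage_ballE => -[e e_gt0 eE].
  by exists e => // x y xy; exact: (eE (x, y)).
set S := ereal_sup _ in H_sum.
pose B := `|fine S| + 1.
have B_gt0 : 0 < B by rewrite ltr_pwDr.
have HB h j : H h -> \sum_(0 <= k < j) `|h (lattice_point delta k)| <= B.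
  move=> Hh; apply: lattice_abs_tail_bound.
  have hS : (lattice_abs_tail h 0 <= S)%E by apply: ereal_sup_ubound; exists h.
  have S_fin : S \is a fin_num.
    rewrite ge0_fin_numE//; apply: le_trans hS.
    by apply: nneseries_ge0 => k _ _; rewrite lee_fin.
  apply: le_trans hS _; rewrite -(fineK S_fin) lee_fin.
  by rewrite (le_trans (ler_norm _))// lerDl.
have [K tailK] : exists K, forall h j, H h ->
    \sum_(K <= k < j) `|h (lattice_point delta k)| <= eps / 8.
  have /H_tail[K _ KP] : nbhs (0%E : \bar R) [set y | (y < (eps / 8)%:E)%E].
    by apply: open_ereal_lt'; rewrite lte_fin divr_gt0.
  exists K => h j Hh; apply: lattice_abs_tail_bound.
  have /= /ltW := KP K (leqnn K); apply: le_trans.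
  by apply: ereal_sup_ubound; exists h.
(* The bound of [convolution_error] becomes [eps / 4 + eps / 8 + eps / 8]. *)
have eta_gt0 : 0 < eps / (4 * B) by rewrite divr_gt0// mulr_gt0.
have [N _ NP] := uniform_renewal_measure delta_gt0 M_compact M_span M_ui eta_gt0.
exists (K + N)%N => // n KNn; apply: EP => -[mu h] [/= Mmu Hh]; apply: epsE.
rewrite distrC.
have muP : mu (positive_lattice delta) = 1%E by apply: span_lattice => //; exact: M_span.
have pP := lattice_weight_step_law delta_gt0 muP.
have uP := (renewal_measure_sequence delta_gt0 muP).2.
have u01 j : 0 <= fine (renewal_measure mu [set j%:R * delta]) <= 1.
  by rewrite (renewal_ge0 j pP uP) (renewal_le1 j pP uP).
have c01 : 0 <= delta * renewal_rate mu <= 1.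
  have [N0 /(_ _ Mmu) N0P] := uniform_tail_mean delta_gt0 M_ui (@ltr01 R).
  have [m [-> m_ge _]] := mean_lattice_le delta_gt0 muP N0P.
  have m1 : 1 <= m by have := m_ge 1%N; rewrite /truncated_mean big_ord1 tail0.
  by rewrite invr_ge0 invf_le1 ?m1 ?andbT ?ltW// (lt_le_trans ltr01 m1).
have := convolution_error u01 c01 (fun j Nj => NP j Nj mu Mmu)
  (fun j => HB h j Hh) (fun j => tailK h j Hh) KNn.
move=> /le_lt_trans; apply.
rewrite (_ : eps / (4 * B) * B = eps / 4); last by field; exact: lt0r_neq0.
by lra.
Qed.
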